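(* Let $$F(z)=\sum_{\alpha\in\mathbb{N}^n}c_\alpha z^\alpha\in\mathbb{C}[[z_1,\ldots,z_n]]$$ be a formal power series. If the restriction of $F$ to every complex line through the origin is convergent in a neighborhood of the origin, then $F$ is convergent in a neighborhood of the origin (in $\mathbb{C}^n$).
   Context: $\mathbb{N}=\{0,1,2,\ldots\}$ and $\mathbb{C}[[z_1,\ldots,z_n]]$ is the ring of formal power series in $z_1,\ldots,z_n$ over $\mathbb{C}$. For $c\in\mathbb{C}^n$ with $\|c\|=1$, the restriction of $F$ to the complex line $\mathbb{C}c$ through the origin is the formal power series in one variable $\lambda$ $$\sum_{\alpha\in\mathbb{N}^n}c_\alpha(\lambda c)^\alpha=\sum_{m\ge 0}\Big(\sum_{|\alpha|=m}c_\alpha c^\alpha\Big)\lambda^m .$$ The hypothesis is that for every such $c$ this series converges in some neighborhood of $\lambda=0$; the neighborhood may depend on $c$. The conclusion is that $F$ belongs to the ring $\mathbb{C}\{z_1,\ldots,z_n\}$ of convergent power series. *)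

(* Defs.v *)
From mathcomp Require Export all_boot all_order all_algebra.
From mathcomp Require Export all_classical all_reals all_analysis.
From mathcomp Require Export complex.
Export Order.TTheory GRing.Theory Num.Theory.
Export numFieldNormedType.Exports.

Set Implicit Arguments.
Unset Strict Implicit.
Unset Printing Implicit Defensive.

Local Open Scope classical_set_scope.
Local Open Scope ring_scope.
Local Open Scope complex_scope.

(* The regular-module alias [^o] gives [R[i]] the topology of its norm. *)
Notation Cplx R := (R[i]^o).

Notation multiidx n := {ffun 'I_n -> nat}.

Section MultiIndex.
Variable n : nat.

Definition mdeg (a : multiidx n) : nat := (\sum_(i < n) a i)%N.

(* The finitely supported sums over [mdeg a = m] below are genuine sums. *)
Lemma finite_mdeg (m : nat) : finite_set [set a : multiidx n | mdeg a = m].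
Proof.
apply: (@sub_finite_set _ _
  ((fun f : {ffun 'I_n -> 'I_m.+1} => [ffun i => f i : nat]) @` setT)).
  move=> a /= am; exists [ffun i => inord (a i)] => //.
  apply/ffunP => i; rewrite !ffunE inordK// ltnS -am /mdeg.
  by rewrite (bigD1 i)//= leq_addr.
exact/finite_image/finite_finset.
Qed.

End MultiIndex.

Section PowerSeries.
Variables (R : realType) (n : nat).
Local Notation C := (Cplx R).

Definition mpow (z : 'rV[C]_n) (a : multiidx n) : C :=
  \prod_(i < n) z ord0 i ^+ a i.

Definition enorm (z : 'rV[C]_n) : R :=
  Num.sqrt (\sum_(i < n) ComplexField.Normc.normc (z ord0 i) ^+ 2).

(* An element of C[[z_1, ..., z_n]], given by its family of coefficients. *)
Definition fps := multiidx n -> C.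

(* Convergence of a multiple series carries no order of summation, hence
   means absolute convergence. *)
Definition fps_cvg_at (F : fps) (z : 'rV[C]_n) : Prop :=
  (\esum_(a in [set: multiidx n])
     (ComplexField.Normc.normc (F a * mpow z a))%:E < +oo)%E.

Definition fps_convergent (F : fps) : Prop :=
  \forall z \near (0 : 'rV[C]_n), fps_cvg_at F z.

(* The coefficients of [F(l c)] as a formal power series in [l]. *)
Definition line_coef (F : fps) (c : 'rV[C]_n) (m : nat) : C :=
  \sum_(a \in [set a : multiidx n | mdeg a = m]) F a * mpow c a.

Definition convergent1 (u : nat -> C) : Prop :=
  \forall l \near (0 : C), cvgn (series (fun m => u m * l ^+ m)).

End PowerSeries.

(* Main.v *)
From HB Require Import structures.
Require Import Defs.
From mathcomp Require Import finmap ring.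
Import ComplexField.Normc.
Local Open Scope ring_scope.
Local Open Scope classical_set_scope.

(** Let P_m be the homogeneous part of F of degree m. Convergence on lines says
    that every point c admits a K with |P_m(c)| <= K^(m+1) for all m. It is
    enough to use this at real points c, where the real and imaginary parts of
    the coefficients of F can be treated separately. By Baire's theorem a
    single K serves for a whole box of R^n. For |a| = m, the coefficient of z^a
    in P_m is a!^-1 h^-a times the mixed finite difference of order a and step
    h of P_m: the other monomials of degree m have a smaller exponent in some
    variable and are killed. Taking h_i = r/(a_i+1) keeps the nodes inside the
    box, and (p+1)^p <= e^p p! then gives a geometric bound on the
    coefficients. *)

(** * One-variable finite differences and a factorial estimate *)

Lemma finite_difference_exp (A : comNzRingType) (h : A) (p q : nat) (x : A) :
  (q <= p)%N ->
  \sum_(k < p.+1) (-1) ^+ k * 'C(p, k)%:R * (x + k%:R * h) ^+ q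
  = (q == p)%:R * ((-1) ^+ p * p`!%:R * h ^+ p).
Proof.
elim: p q x => [|p IHp] q x.
  rewrite leqn0 => /eqP ->.
  by rewrite big_ord_recl big_ord0 !expr0 bin0 fact0 !mulr1 addr0.
elim: q => [_|q IHq]; last first.
  rewrite ltnS => qp.
  (* One factor x + k h is split off. Its part k h is absorbed by k C(p+1, k) = (p+1) C(p, k-1),
     which leaves a difference of order [p] based at [x + h]. *)
  have -> : \sum_(k < p.+2) (-1) ^+ k * 'C(p.+1, k)%:R * (x + k%:R * h) ^+ q.+1
    = x * (\sum_(k < p.+2) (-1) ^+ k * 'C(p.+1, k)%:R * (x + k%:R * h) ^+ q)
      - p.+1%:R * h * (\sum_(k < p.+1) (-1) ^+ k * 'C(p, k)%:R *
          ((x + h) + k%:R * h) ^+ q).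
    have -> : p.+1%:R * h * (\sum_(k < p.+1) (-1) ^+ k * 'C(p, k)%:R *
          ((x + h) + k%:R * h) ^+ q)
      = - \sum_(k < p.+2) (-1) ^+ k * (k * 'C(p.+1, k))%:R * h *
            (x + k%:R * h) ^+ q.
      rewrite [in RHS]big_ord_recl mul0n mulr0 !mul0r add0r mulr_sumr -sumrN.
      apply: eq_bigr => k _; rewrite lift0 -mul_bin_diag natrM exprS.
      have -> : k.+1%:R = k%:R + 1 :> A by rewrite natr1.
      have -> : x + h + k%:R * h = x + (k%:R + 1) * h by ring.
      by move=> /=; ring.
    rewrite opprK mulr_sumr -big_split/=; apply: eq_bigr => k _.
    by rewrite exprS natrM; ring.
  (* The first difference vanishes because q < p+1; the second is known by induction on [p]. *)
  rewrite IHq ?(leq_trans qp)// IHp// (ltn_eqF (_ : q < p.+1)%N)// eqSS.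
  by rewrite factS natrM !exprS mul0r mulr0; move: (_ == _)%:R => d; ring.
(* For exponent 0 the sum is the binomial expansion of (1 - 1)^(p+1). *)
under eq_bigr do rewrite expr0 mulr1.
rewrite mul0r -[RHS](expr0n A p.+1) -[X in X ^+ p.+1](subrr (1 : A)) exprBn.
by apply: eq_bigr => k _; rewrite !expr1n mulr1 mulr1 mulr_natr.
Qed.

(** From [p] to [p.+1] the left side grows by the factor (p+1) (1 + 1/(p+1))^(p+1) and the right
    side by (p+1) e; the inequality 1 + t <= exp t compares the two. *)
Lemma expn_fact_bound (R : realType) (p : nat) :
  p.+1%:R ^+ p <= expR 1 ^+ p * p`!%:R :> R.
Proof.
elim: p => [|p IH]; first by rewrite !expr0 mul1r.
have p0 : 0 < p.+1%:R :> R by rewrite ltr0n.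
have ratio : (1 + p.+1%:R^-1) ^+ p.+1 <= expR 1 :> R.
  rewrite -[leRHS](_ : expR (p.+1%:R^-1) ^+ p.+1 = _).
    by rewrite lerXn2r ?nnegrE ?addr_ge0 ?invr_ge0 ?expR_ge0 ?expR_ge1Dx.
  by rewrite -expRM_natl mulfV ?gt_eqF.
have -> : p.+2%:R = (1 + p.+1%:R^-1) * p.+1%:R :> R.
  by rewrite mulrDl mul1r mulVf ?gt_eqF// -[p.+2]addn1 natrD.
rewrite exprMn factS natrM (exprS (expR 1)) (exprS p.+1%:R).
have -> : expR 1 * expR 1 ^+ p * (p.+1%:R * p`!%:R) =
  expR 1 * (p.+1%:R * (expR 1 ^+ p * p`!%:R)) :> R by ring.
by apply: ler_pM => //; rewrite ler_wpM2l.
Qed.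

(** * Coefficients of real homogeneous polynomials from mixed differences *)

Section Homogeneous.
Variables (R : realType) (n : nat).
Implicit Types (G : multiidx n -> R) (x : 'rV[R]_n).

(** Real counterpart of [line_coef]; [G] will be the real or the imaginary part of the coefficients
    of [F]. *)
Definition hsum G (m : nat) x : R :=
  \sum_(a \in [set a : multiidx n | mdeg a = m])
    G a * \prod_(i < n) x ord0 i ^+ a i.

Lemma hsumE G m x : hsum G m x =
  \sum_(a <- fset_set [set a : multiidx n | mdeg a = m])
    G a * \prod_(i < n) x ord0 i ^+ a i.
Proof. by rewrite /hsum fsbig_finite//; exact: finite_mdeg. Qed.

Lemma mem_mdeg_fset m (a : multiidx n) :
  (a \in fset_set [set a : multiidx n | mdeg a = m]) = (mdeg a == m).
Proof.
rewrite in_fset_set; last exact: finite_mdeg.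
by apply/idP/eqP => [/set_mem|am]//; apply/mem_set.
Qed.

(** Otherwise [a i <= b i] for all [i], and equal sums force equality termwise. In the variable
    found, a difference of order [a i] kills the monomial of exponent [b]. *)
Lemma mdeg_eq_ltn (a b : multiidx n) :
  mdeg b = mdeg a -> b != a -> exists i, (b i < a i)%N.
Proof.
move=> ab /eqP ba; apply: contrapT => /forallNP H; apply: ba.
have le i : (a i <= b i)%N by rewrite leqNgt; apply/negP/H.
apply/ffunP => i; apply/eqP; rewrite eq_sym; move: i; apply/forallP.
have := leqif_sum (fun i (_ : true) => leqif_eq (le i)).
by rewrite -/(mdeg _) -/(mdeg _) => -[_]; rewrite ab eqxx => <-.
Qed.

(** On each monomial the sum over [f] factors, by distributivity, into one-variable differences. The
    values [f i] live in the common range up to [mdeg a], which contains every [a i]; the family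
    condition cuts it back to [a i]. *)
Lemma tensor_finite_difference G (c : 'rV[R]_n) (h : 'I_n -> R)
    (a : multiidx n) :
  \sum_(f in family (fun i (k : 'I_(mdeg a).+1) => (k <= a i)%N))
    (\prod_i ((-1) ^+ f i * 'C(a i, f i)%:R)) *
      hsum G (mdeg a) (\row_i (c ord0 i + (f i)%:R * h i))
  = G a * \prod_i ((-1) ^+ a i * (a i)`!%:R * h i ^+ a i).
Proof.
have dif (b : multiidx n) : mdeg b = mdeg a ->
    \sum_(f in family (fun i (k : 'I_(mdeg a).+1) => (k <= a i)%N))
      \prod_i ((-1) ^+ f i * 'C(a i, f i)%:R *
         (c ord0 i + (f i)%:R * h i) ^+ b i)
    = (b == a)%:R * \prod_i ((-1) ^+ a i * (a i)`!%:R * h i ^+ a i).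
  move=> ab; rewrite -(bigA_distr_big_dep (fun i (k : 'I_(mdeg a).+1) =>
    (k <= a i)%N) (fun i k => (-1) ^+ k * 'C(a i, k)%:R *
         (c ord0 i + k%:R * h i) ^+ b i)).
  have widen i : \sum_(k < (mdeg a).+1 | (k <= a i)%N)
      (-1) ^+ k * 'C(a i, k)%:R * (c ord0 i + k%:R * h i) ^+ b i
    = \sum_(k < (a i).+1)
      (-1) ^+ k * 'C(a i, k)%:R * (c ord0 i + k%:R * h i) ^+ b i.
    rewrite (big_ord_widen (mdeg a).+1 (fun k => (-1) ^+ k * 'C(a i, k)%:R *
      (c ord0 i + k%:R * h i) ^+ b i))//.
    by rewrite ltnS /mdeg (bigD1 i)//= leq_addr.
  under eq_bigr do rewrite widen.
  have [->|ba] := eqVneq b a.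
    rewrite mul1r; apply: eq_bigr => i _.
    by rewrite finite_difference_exp// eqxx mul1r.
  have [i bai] := mdeg_eq_ltn _ _ ab ba.
  rewrite mul0r (bigD1 i)//= (finite_difference_exp _ _ _ _ _ (ltnW bai)).
  by rewrite (ltn_eqF bai) !mul0r.
under [LHS]eq_bigr => f _ do rewrite hsumE mulr_sumr.
rewrite exchange_big/= (bigD1_seq a)/=; last 2 first.
- by rewrite mem_mdeg_fset.
- exact: fset_uniq.
rewrite [X in _ + X]big1_seq ?addr0 => [|b /andP[ba]]; last first.
  rewrite mem_mdeg_fset => /eqP ab.
  transitivity (G b * \sum_(f in family (fun i (k : 'I_(mdeg a).+1) =>
     (k <= a i)%N)) \prod_i ((-1) ^+ f i * 'C(a i, f i)%:R *
         (c ord0 i + (f i)%:R * h i) ^+ b i)); last first.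
    by rewrite dif// (negbTE ba) mul0r mulr0.
  rewrite mulr_sumr; apply: eq_bigr => f _.
  rewrite mulrCA -big_split/=; congr (_ * _); apply: eq_bigr => i _.
  by rewrite mxE.
transitivity (G a * \sum_(f in family (fun i (k : 'I_(mdeg a).+1) =>
     (k <= a i)%N)) \prod_i ((-1) ^+ f i * 'C(a i, f i)%:R *
         (c ord0 i + (f i)%:R * h i) ^+ a i)); last first.
  by rewrite dif// eqxx mul1r.
rewrite mulr_sumr; apply: eq_bigr => f _.
rewrite mulrCA -big_split/=; congr (_ * _); apply: eq_bigr => i _.
by rewrite mxE.
Qed.

Lemma coef_bound G (c : 'rV[R]_n) (r M : R) (a : multiidx n) : 0 < r ->
  (forall x, (forall i, `|x ord0 i - c ord0 i| < r) ->
     `|hsum G (mdeg a) x| <= M) ->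
  `|G a| <= M * (2 * expR 1 / r) ^+ mdeg a.
Proof.
move=> r0 HM; have r0' := ltW r0; pose h i := r / (a i).+1%:R.
have M0 : 0 <= M.
  apply: le_trans (HM c _) => // i; by rewrite subrr normr0.
have prodX (t : R) : t ^+ mdeg a = \prod_i t ^+ a i.
  by rewrite /mdeg; elim/big_rec2: _ => [|i y1 y2 _ <-]; rewrite ?expr0// exprD.
(* The factor that multiplies [G a] is bounded below: a_i! (r/(a_i+1))^(a_i) >= (r/e)^(a_i) by
   [expn_fact_bound]. *)
have lo : (r / expR 1) ^+ mdeg a <=
    \prod_i `|(-1) ^+ a i * (a i)`!%:R * h i ^+ a i|.
  rewrite prodX; apply: ler_prod => i _.
  have e0 := expR_gt0 (1 : R); have e0' := ltW e0.
  rewrite exprn_ge0 ?divr_ge0//=.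
  rewrite !normrM normrX normrN1 expr1n mul1r.
  rewrite !ger0_norm ?exprn_ge0 ?divr_ge0// /h !expr_div_n.
  rewrite mulrCA ler_pM2l ?exprn_gt0// ler_pdivlMr ?exprn_gt0 ?ltr0n//.
  rewrite mulrC ler_pdivrMr ?exprn_gt0// mulrC; exact: expn_fact_bound.
(* The nodes satisfy k h_i < r for k <= a_i, so [M] bounds every value; the binomials in each
   variable add up to 2^(a_i). *)
have up : `|G a| * \prod_i `|(-1) ^+ a i * (a i)`!%:R * h i ^+ a i|
    <= M * 2 ^+ mdeg a.
  rewrite -normr_prod -normrM -(tensor_finite_difference _ c).
  apply: le_trans (ler_norm_sum _ _ _) _.
  apply: (@le_trans _ _ (\sum_(f in family (fun i (k : 'I_(mdeg a).+1) =>
     (k <= a i)%N)) (\prod_i 'C(a i, f i)%:R) * M)).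
    apply: ler_sum => f /familyP fa; rewrite normrM ler_pM//.
      rewrite normr_prod le_eqVlt; apply/orP/or_introl/eqP/eq_bigr => i _.
      by rewrite normrM normrX normrN1 expr1n mul1r ger0_norm.
    apply: HM => i; rewrite mxE addrAC subrr add0r /h normrM normr_nat.
    rewrite ger0_norm ?divr_ge0// mulrA ltr_pdivrMr ?ltr0n//.
    by rewrite mulrC ltr_pM2l// ltr_nat ltnS; exact: fa.
  rewrite -mulr_suml mulrC ler_wpM2l// -(bigA_distr_big_dep
    (fun i (k : 'I_(mdeg a).+1) => (k <= a i)%N)
    (fun i k => 'C(a i, k)%:R)).
  rewrite prodX; apply: ler_prod => i _; apply/andP; split.
    by apply: sumr_ge0.
  have -> : \sum_(k < (mdeg a).+1 | (k <= a i)%N) 'C(a i, k)%:R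
      = \sum_(k < (a i).+1) 'C(a i, k)%:R :> R.
    rewrite (big_ord_widen (mdeg a).+1 (fun k => 'C(a i, k)%:R : R))//.
    by rewrite ltnS /mdeg (bigD1 i)//= leq_addr.
  rewrite -[2]/(1 + 1) exprDn le_eqVlt; apply/orP/or_introl/eqP/eq_bigr => k _.
  by rewrite !expr1n mulr1.
have e0 := expR_gt0 (1 : R).
have re0 : 0 < (r / expR 1) ^+ mdeg a by rewrite exprn_gt0 ?divr_gt0.
have -> : M * (2 * expR 1 / r) ^+ mdeg a =
   M * 2 ^+ mdeg a / (r / expR 1) ^+ mdeg a.
  by rewrite -exprVn invf_div -[in RHS]mulrA -exprMn [2 * (_ / _)]mulrA.
rewrite ler_pdivlMr//; apply: le_trans up.
by rewrite ler_wpM2l.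
Qed.

End Homogeneous.

Arguments hsum {R n}.

(** Combines completeness with the norm on real matrices, so that [Baire] applies to ['rV[R]_n]. *)
HB.instance Definition _ (K : realType) (m n : nat) :=
  Complete.on 'M[K]_(m, n).

(** * Uniform bounds on a box by Baire's theorem *)

Section Uniform.
Variables (R : realType) (n : nat) (G : multiidx n -> R).

Lemma hsum_continuous m : continuous (hsum G m).
Proof.
rewrite (_ : hsum G m = fun y =>
  \sum_(a <- fset_set [set a : multiidx n | mdeg a = m])
    G a * \prod_(i < n) y ord0 i ^+ a i); last first.
  by apply/funext => y; rewrite hsumE.
apply: continuous_big => [|a _ x]; first exact: add_continuous.
apply: continuousM; first exact: cst_continuous.
move: x; apply: continuous_big => [|i _ x]; first exact: mul_continuous.
apply: (@continuous_comp _ _ _ (fun y : 'rV[R]_n => y ord0 i)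
  (fun t : R => t ^+ a i)); [exact: coord_continuous|exact: exprn_continuous].
Qed.

(** The exponent is [m.+1] so that the bound at m = 0 still depends on [k] and can accommodate any
    constant term. *)
Let E (k : nat) : set 'rV[R]_n :=
  [set x | forall m, `|hsum G m x| <= k%:R ^+ m.+1].

Lemma closed_hsum_le k : closed (E k).
Proof.
rewrite (_ : E k = \bigcap_m [set x | `|hsum G m x| <= k%:R ^+ m.+1]).
  apply: closed_bigI => m _.
  apply: (@preimage_closed _ _ (fun x => `|hsum G m x|) [set t | t <= _]).
    move=> x _; apply: continuous_comp; first exact: hsum_continuous.
    exact: norm_continuous.
  exact: closed_le.
by apply/seteqP; split => x Ex m => [_|]; exact: Ex.
Qed.

Lemma hsum_uniform_bound :
  (forall x : 'rV[R]_n, exists K : R, forall m, `|hsum G m x| <= K ^+ m.+1) ->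
  exists (k : nat) (c : 'rV[R]_n) (r : R), 0 < r /\
    forall x : 'rV[R]_n, (forall i, `|x ord0 i - c ord0 i| < r) ->
      forall m, `|hsum G m x| <= k%:R ^+ m.+1.
Proof.
move=> HG.
have [k Ek] : exists k, ~ dense (~` E k).
  apply: contrapT => /forallNP dE.
  have /Baire : forall k, open (~` E k) /\ dense (~` E k).
    move=> k; split; last exact: contrapT (dE k).
    by apply: closed_openC; exact: closed_hsum_le.
  move=> /(_ setT) []; [by exists 0|exact: openT|].
  move=> x [_ Ex]; have [K HK] := HG x.
  have K0 : 0 <= K by have := HK 0%N; rewrite expr1; exact: le_trans.
  apply: (Ex (Num.truncn K).+1) => // m; apply: le_trans (HK m) _.
  by rewrite lerXn2r ?nnegrE// ltW// truncnS_gt.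
(* Failure of density gives a nonempty open [D] inside [E k]. A ball in [D] is already a box, the
   norm being the sup norm. *)
move: Ek => /existsNP[D] /not_implyP[[c Dc]] /not_implyP[oD DE].
have : nbhs c D by exact: open_nbhs_nbhs.
move=> /nbhs_ballP[r /= r0 cD]; exists k, c, r; split => // x xc m.
apply: contrapT => xE; apply: DE; exists x; split.
  by apply: cD; split=> // i j; rewrite ord1 -ball_normE /ball_/= distrC.
by move=> Ex; apply: xE; exact: Ex.
Qed.

Lemma coef_geometric_bound :
  (forall x : 'rV[R]_n, exists K : R, forall m, `|hsum G m x| <= K ^+ m.+1) ->
  exists L : R, forall a : multiidx n, `|G a| <= L ^+ (mdeg a).+1.
Proof.
move=> /hsum_uniform_bound[k [c [r [r0 H]]]].
have e0 := ltW (expR_gt0 (1 : R)).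
pose q := 2 * expR 1 / r.
have q0 : 0 <= q by rewrite divr_ge0 ?mulr_ge0// ltW.
(* Since 1 + q >= 1, k^(m+1) q^m <= (k (1 + q))^(m+1). *)
exists (k%:R * (1 + q)) => a.
apply: le_trans (coef_bound _ _ _ c r (k%:R ^+ (mdeg a).+1) a r0 _) _.
  by move=> x xc; exact: H.
rewrite -/q [leRHS]exprMn ler_wpM2l ?exprn_ge0// exprS.
have qX : q ^+ mdeg a <= (1 + q) ^+ mdeg a.
  by rewrite lerXn2r ?nnegrE ?addr_ge0// lerDr.
apply: le_trans qX _; rewrite ler_peMl ?lerDl//.
by rewrite exprn_ge0 ?addr_ge0.
Qed.

End Uniform.

(** * The complex modulus and one-variable convergent series *)

Lemma normc_ge0 (R : rcfType) (z : R[i]) : 0 <= normc z.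
Proof. by case: z => a b; exact: sqrtr_ge0. Qed.

Lemma normcX (R : rcfType) (z : R[i]) m : normc (z ^+ m) = normc z ^+ m.
Proof. by elim: m => [|m IH]; rewrite ?expr0 ?normc1// !exprS normcM IH. Qed.

Lemma normc_real (R : rcfType) (t : R) : normc t%:C%C = `|t|.
Proof. by rewrite /= expr0n addr0 sqrtr_sqr. Qed.

Lemma Re_le_normc (R : rcfType) (z : R[i]) : `|complex.Re z| <= normc z.
Proof.
by case: z => a b /=; rewrite -[leLHS]sqrtr_sqr ler_wsqrtr// lerDl sqr_ge0.
Qed.

Lemma Im_le_normc (R : rcfType) (z : R[i]) : `|complex.Im z| <= normc z.
Proof.
by case: z => a b /=; rewrite -[leLHS]sqrtr_sqr ler_wsqrtr// lerDr sqr_ge0.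
Qed.

Lemma normc_le_ReIm (R : rcfType) (z : R[i]) :
  normc z <= `|complex.Re z| + `|complex.Im z|.
Proof.
case: z => a b /=; rewrite -[leRHS]ger0_norm ?addr_ge0// -[leRHS]sqrtr_sqr.
rewrite ler_wsqrtr// sqrrD !real_normK ?num_real// -addrA addrCA lerDr.
by rewrite mulrn_wge0// mulr_ge0.
Qed.

Lemma convergent1_bound (R : realType) (u : nat -> Cplx R) :
  convergent1 u -> exists K : R, forall m, normc (u m) <= K ^+ m.+1.
Proof.
move=> /nbhs_ballP[e /= e0 He].
have /He/cvg_series_cvg_0 : ball (0 : Cplx R) e (e / 2).
  rewrite -ball_normE /ball_/= sub0r normrN ger0_norm ?divr_ge0 ?ltW//.
  by rewrite ltr_pdivrMr// ltr_pMr// ltr1n.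
move=> /cvgrPdist_lt/(_ 1 ltr01)[N _ HN].
pose t := normc (e / 2); pose v m := normc (u m * (e / 2) ^+ m).
have t0 : 0 < t.
  rewrite lt_neqAle normc_ge0 andbT eq_sym; apply/eqP => /eq0_normc/eqP.
  by rewrite mulf_eq0 invr_eq0 pnatr_eq0 orbF gt_eqF.
(* From [N] on the terms at the point e/2 are below 1; the earlier ones are bounded by their sum. *)
pose B := 1 + \sum_(m < N) v m.
have B1 : 1 <= B by rewrite lerDl sumr_ge0// => m _; exact: normc_ge0.
have vB m : v m <= B.
  have [Nm|mN] := leqP N m.
    apply: le_trans B1; have /ltW := HN _ Nm.
    by rewrite sub0r normrN -lecR.
  rewrite /B (bigD1 (Ordinal mN))//= addrCA lerDl addr_ge0// sumr_ge0// => i _.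
  exact: normc_ge0.
(* The coefficient is at most B t^(-m), and both [B] and [t^-1] are below this base. *)
exists (B + t^-1) => m.
have ti0 : 0 <= t^-1 by rewrite invr_ge0 ltW.
have B0 : 0 <= B by exact: le_trans B1.
have -> : normc (u m) = v m * t^-1 ^+ m.
  by rewrite /v normcM normcX -/t -mulrA -exprMn mulfV ?gt_eqF// expr1n mulr1.
rewrite exprS ler_pM ?exprn_ge0 ?normc_ge0//.
  by rewrite (le_trans (vB m))// lerDl.
by rewrite lerXn2r ?nnegrE ?lerDr// (addr_ge0 B0).
Qed.

(** * From convergence on lines to a geometric bound on the coefficients *)

Section Lines.
Variables (R : realType) (n : nat) (F : fps R n).
Local Notation C := (Cplx R).

Lemma mpowZ (s : C) (c : 'rV[C]_n) a : mpow (s *: c) a = s ^+ mdeg a * mpow c a.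
Proof.
rewrite /mpow /mdeg -prodrXr -big_split/=; apply: eq_bigr => i _.
by rewrite mxE exprMn.
Qed.

Lemma line_coefZ (s : C) (c : 'rV[C]_n) m :
  line_coef F (s *: c) m = s ^+ m * line_coef F c m.
Proof.
rewrite /line_coef !fsbig_finite; [|exact: finite_mdeg..].
rewrite mulr_sumr [LHS]big_seq [RHS]big_seq; apply: eq_bigr => a.
by rewrite mem_mdeg_fset => /eqP <-; rewrite mpowZ mulrCA.
Qed.

Lemma enormZ (s : C) (c : 'rV[C]_n) : enorm (s *: c) = normc s * enorm c.
Proof.
rewrite /enorm; under eq_bigr do rewrite mxE normcM exprMn.
by rewrite -mulr_sumr sqrtrM ?sqr_ge0// sqrtr_sqr ger0_norm// normc_ge0.
Qed.

Lemma enorm_eq0 (c : 'rV[C]_n) : enorm c = 0 -> c = 0.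
Proof.
move=> /eqP; rewrite sqrtr_eq0 => c0; apply/rowP => i; rewrite mxE.
apply/eq0_normc/eqP; rewrite -sqrf_eq0 eq_le sqr_ge0 andbT.
apply: le_trans c0; rewrite (bigD1 i)//= lerDl.
by apply: sumr_ge0 => j _; exact: sqr_ge0.
Qed.

(** Homogeneity carries the bound from the unit vector c/|c| to [c]; at the origin only degree 0
    survives. *)
Lemma line_coef_bound (c : 'rV[C]_n) :
  (forall c : 'rV[C]_n, enorm c = 1 -> convergent1 (line_coef F c)) ->
  exists K : R, forall m, normc (line_coef F c m) <= K ^+ m.+1.
Proof.
move=> cvF; have [/enorm_eq0 ->|c0] := eqVneq (enorm c) 0.
  exists (normc (line_coef F 0 0)) => -[|m]; first by rewrite expr1.
  rewrite -(scale0r 0) line_coefZ expr0n mul0r normc0.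
  by rewrite exprn_ge0// normc_ge0.
have s0 : 0 <= enorm c by exact: sqrtr_ge0.
pose c' := (enorm c)^-1%:C%C *: c.
have c'1 : enorm c' = 1.
  by rewrite enormZ normc_real ger0_norm ?invr_ge0// mulVf.
have -> : c = (enorm c)%:C%C *: c'.
  by rewrite scalerA -rmorphM mulfV// scale1r.
have [K HK] := convergent1_bound _ _ (cvF _ c'1).
have K0 : 0 <= K.
  by have := HK 0%N; rewrite expr1; apply: le_trans; exact: normc_ge0.
(* The summand 1 allows |c|^m <= (1 + |c|)^(m+1), whether |c| is small or large. *)
exists ((1 + enorm c) * K) => m.
rewrite line_coefZ normcM normcX normc_real ger0_norm// exprMn.
rewrite ler_pM ?exprn_ge0 ?normc_ge0//.
apply: (@le_trans _ _ ((1 + enorm c) ^+ m)).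
  by rewrite lerXn2r ?nnegrE ?addr_ge0// lerDr.
by rewrite exprS ler_peMl ?exprn_ge0 ?addr_ge0// lerDl.
Qed.

(* [phi] stands for the real or the imaginary part. *)
Lemma real_part_bound (phi : C -> R) :
  (forall c : 'rV[C]_n, enorm c = 1 -> convergent1 (line_coef F c)) ->
  phi 0 = 0 -> {morph phi : x y / x + y} ->
  (forall z (t : R), phi (z * t%:C%C) = phi z * t) ->
  (forall z, `|phi z| <= normc z) ->
  exists L : R, forall a : multiidx n, `|phi (F a)| <= L ^+ (mdeg a).+1.
Proof.
move=> cvF phi0 phiD phiZ phi_le; apply: coef_geometric_bound => x.
have [K HK] := line_coef_bound (map_mx (real_complex R) x) cvF.
exists K => m; apply: le_trans (HK m); apply: le_trans (phi_le _).
rewrite hsumE /line_coef fsbig_finite; last exact: finite_mdeg.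
(* At a real point the monomials are real, so [phi] passes to the coefficients. *)
rewrite (big_morph phi phiD phi0) le_eqVlt; apply/orP/or_introl/eqP.
congr `|_|; apply: eq_bigr => a _; rewrite -phiZ rmorph_prod.
by congr (phi (_ * _)); apply: eq_bigr => i _; rewrite mxE rmorphXn.
Qed.

Lemma fps_coef_bound :
  (forall c : 'rV[C]_n, enorm c = 1 -> convergent1 (line_coef F c)) ->
  exists L : R, forall a : multiidx n, normc (F a) <= L ^+ (mdeg a).+1.
Proof.
move=> cvF; have [L1 H1] : exists L : R, forall a : multiidx n,
    `|complex.Re (F a)| <= L ^+ (mdeg a).+1.
  apply: real_part_bound => //; [by case=> ? ? []| |exact: Re_le_normc].
  by move=> [a b] t /=; rewrite mulr0 subr0.
have [L2 H2] : exists L : R, forall a : multiidx n,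
    `|complex.Im (F a)| <= L ^+ (mdeg a).+1.
  apply: real_part_bound => //; [by case=> ? ? []| |exact: Im_le_normc].
  by move=> [a b] t /=; rewrite mulr0 add0r.
(* For x, y >= 0, x^(m+1) + y^(m+1) <= (x + y)^(m+1); the absolute values make the bases
   nonnegative. *)
exists (`|L1| + `|L2|) => a; apply: le_trans (normc_le_ReIm _ _) _.
have /le_trans : `|complex.Re (F a)| <= `|L1| ^+ (mdeg a).+1.
  by rewrite (le_trans (H1 a))// -normrX ler_norm.
have /le_trans : `|complex.Im (F a)| <= `|L2| ^+ (mdeg a).+1.
  by rewrite (le_trans (H2 a))// -normrX ler_norm.
move=> H2' H1'; apply: le_trans (lerD (H1' _ (lexx _)) (H2' _ (lexx _))) _.
rewrite !exprS mulrDl lerD// ler_wpM2l// lerXn2r ?nnegrE ?addr_ge0//.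
  by rewrite lerDl.
by rewrite lerDr.
Qed.

End Lines.

(** * A geometric coefficient bound implies convergence *)

Lemma sum_half_le2 (R : realFieldType) N : \sum_(k < N) (1 / 2) ^+ k <= 2 :> R.
Proof.
suff -> : \sum_(k < N) (1 / 2) ^+ k = 2 - 2 * (1 / 2) ^+ N :> R.
  by rewrite lerBlDr lerDl mulr_ge0 ?exprn_ge0.
elim: N => [|N IH]; first by rewrite big_ord0 expr0 mulr1 subrr.
by rewrite big_ord_recr/= IH exprS; field.
Qed.

(** The finitely many indices lie in a box {0, ..., N}^n, over which the sum is a product of [n]
    geometric sums, each at most 2. *)
Lemma sum_prod_half_le (R : realFieldType) n (s : seq (multiidx n)) : uniq s ->
  \sum_(a <- s) \prod_i (1 / 2) ^+ a i <= 2 ^+ n :> R.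
Proof.
move=> us; pose N := (\max_(a <- s) mdeg a)%N.
pose f (a : multiidx n) : {ffun 'I_n -> 'I_N.+1} := [ffun i => inord (a i)].
have fE a i : a \in s -> f a i = a i :> nat.
  move=> sa; rewrite ffunE inordK// ltnS.
  apply: (@leq_trans (mdeg a)); last by rewrite /N (big_rem a)//= leq_maxl.
  by rewrite /mdeg (bigD1 i)//= leq_addr.
have -> : \sum_(a <- s) \prod_i (1 / 2) ^+ a i =
    \sum_(g <- [seq f a | a <- s]) \prod_i (1 / 2) ^+ g i :> R.
  rewrite big_map [LHS]big_seq [RHS]big_seq; apply: eq_bigr => a sa.
  by apply: eq_bigr => i _; rewrite fE.
rewrite big_uniq/=; last first.
  rewrite map_inj_in_uniq// => a b sa sb fab; apply/ffunP => i.
  by rewrite -(fE a)// -(fE b)// fab.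
apply: (@le_trans _ _
    (\sum_(g : {ffun 'I_n -> 'I_N.+1}) \prod_i (1 / 2) ^+ g i)).
  rewrite [leRHS](bigID (mem [seq f a | a <- s]))/= lerDl sumr_ge0// => g _.
  by apply: prodr_ge0 => i _; rewrite exprn_ge0.
rewrite -(bigA_distr_bigA (fun _ (k : 'I_N.+1) => (1 / 2) ^+ k)).
rewrite prodr_const card_ord lerXn2r ?nnegrE ?sum_half_le2//.
by apply: sumr_ge0 => k _; rewrite exprn_ge0.
Qed.

Lemma fps_convergent_of_bound (R : realType) n (F : fps R n) (L : R) :
  (forall a : multiidx n, normc (F a) <= L ^+ (mdeg a).+1) ->
  fps_convergent F.
Proof.
wlog L0 : L / 0 <= L => [wl HL|HL].
  apply: (wl `|L|) => // a; apply: le_trans (HL a) _.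
  by rewrite -normrX ler_norm.
(* Chosen so that L rho <= 1/2; the summand 1 keeps [rho] defined when L = 0. *)
pose rho := (2 * (1 + L))^-1.
have rho0 : 0 < rho by rewrite invr_gt0 mulr_gt0// ltr_pwDl.
have Lrho : L * rho <= 1 / 2.
  rewrite /rho ler_pdivrMr ?mulr_gt0 ?ltr_pwDl//.
  by rewrite mulrA divfK// mul1r lerDr.
have : \forall z \near (0 : 'rV[Cplx R]_n),
      forall i, normc ((z : 'rV[Cplx R]_n) ord0 i) < rho.
  apply: (@filter_forall _ _
    (fun i (z : 'rV[Cplx R]_n) => normc (z ord0 i) < rho) _
    (nbhs_filter _)) => i.
  have rhoC : (0 : R[i]) < rho%:C%C by rewrite ltcR.
  have /cvgrPdist_lt/(_ _ rhoC) :=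
    @coord_continuous R[i] 1 n ord0 i 0.
  by apply: filterS => z; rewrite mxE sub0r normrN -ltcR.
apply: filterS => z zrho; rewrite /fps_cvg_at.
(* The term at [a] is at most L (L rho)^|a| <= L 2^(-|a|), so every finite partial sum is at most L
   2^n. *)
apply: (@le_lt_trans _ _ (L * 2 ^+ n)%:E); last exact: ltry.
apply: ge_ereal_sup => _ [A [finA _] <-].
rewrite fsbig_finite//= sumEFin lee_fin.
apply: (@le_trans _ _ (\sum_(a <- fset_set A) L * \prod_i (1 / 2) ^+ a i)).
  apply: ler_sum => a _; rewrite normcM.
  have -> : normc (mpow z a) = \prod_i normc (z ord0 i) ^+ a i.
    rewrite /mpow (big_morph _ (@normcM R) (@normc1 R)).
    by apply: eq_bigr => i _; rewrite normcX.
  have zle : \prod_i normc (z ord0 i) ^+ a i <= rho ^+ mdeg a.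
    rewrite /mdeg -prodrXr; apply: ler_prod => i _.
    by rewrite exprn_ge0 ?normc_ge0// lerXn2r ?nnegrE ?normc_ge0// ltW.
  apply: (@le_trans _ _ (L ^+ (mdeg a).+1 * rho ^+ mdeg a)).
    rewrite ler_pM ?normc_ge0//; apply: prodr_ge0 => i _.
    by rewrite exprn_ge0 ?normc_ge0.
  rewrite exprS -mulrA -exprMn ler_wpM2l// prodrXr -/(mdeg a).
  by rewrite lerXn2r// nnegrE mulr_ge0// ltW.
by rewrite -mulr_sumr ler_wpM2l// sum_prod_half_le// fset_uniq.
Qed.

Theorem corollary3p5 (R : realType) (n : nat) (F : fps R n) :
  (forall c : 'rV[Cplx R]_n, enorm c = 1 -> convergent1 (line_coef F c)) ->
  fps_convergent F.
Proof.
move=> /fps_coef_bound[L HL]; exact: fps_convergent_of_bound HL.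
Qed.
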